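(* Let $\mathcal X,\mathcal Y,\mathcal Z,\widetilde{\mathcal Z},\mathfrak Z,A,f,\Psi,\mu,\mathfrak L,\Delta,\mathfrak C,B$ be as in the setting described in the context and $J_{\Psi_B\circ\mathfrak L}=f\circ A+\mu\Psi_B\circ\mathfrak L$. Then the following hold. (a) $\Psi_B\circ\mathfrak L$ can be decomposed as $$\Psi_B\circ\mathfrak L=\Psi\circ\mathfrak L-\tfrac12\|B\mathfrak L\cdot\|_{\widetilde{\mathcal Z}}^2+\left(\Psi+\tfrac12\|B\cdot\|_{\widetilde{\mathcal Z}}^2\right)^*\circ B^*B\mathfrak L,$$ where $\left(\Psi+\frac12\|B\cdot\|_{\widetilde{\mathcal Z}}^2\right)^*\circ B^*B\mathfrak L\in\Gamma_0(\mathcal X)$ and its domain is all of $\mathcal X$. Moreover, $\Psi_B\circ\mathfrak L$ is proper, lower semicontinuous and $1$-weakly convex relative to $q_{\mathfrak L^*B^*B\mathfrak L}$, with $\operatorname{dom}(\Psi_B\circ\mathfrak L)=\operatorname{dom}(\Psi\circ\mathfrak L)\neq\emptyset$. (b) $J_{\Psi_B\circ\mathfrak L}$ is proper and lower semicontinuous with $\operatorname{dom}(J_{\Psi_B\circ\mathfrak L})=\operatorname{dom}(\Psi\circ\mathfrak L)\neq\emptyset$. (c) Let $f$ be $1$-strongly convex relative to $q_\Lambda$ with some $\Lambda\in\mathcal B(\mathcal Y,\mathcal Y)$, $\Lambda\succeq0$. Consider the conditions $(C_0)$: $A^*\Lambda A-\mu\mathfrak L^*B^*B\mathfrak L\succeq0$;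 $(C_1)$: $f\circ A$ is $\mu$-strongly convex relative to $q_{\mathfrak L^*B^*B\mathfrak L}$, or equivalently $\mathfrak d:=f\circ A-\frac\mu2\|B\mathfrak L\cdot\|_{\widetilde{\mathcal Z}}^2\in\Gamma_0(\mathcal X)$; $(C_2)$: $J_{\Psi_B\circ\mathfrak L}\in\Gamma_0(\mathcal X)$. Then $(C_0)\Rightarrow(C_1)\Rightarrow(C_2)$. (d) Under $(C_1)$, $J_{\Psi_B\circ\mathfrak L}$ is decomposed into three convex functions: $$J_{\Psi_B\circ\mathfrak L}=\mathfrak d+\mu\Psi\circ\mathfrak L+\mu\left(\Psi+\tfrac12\|B\cdot\|_{\widetilde{\mathcal Z}}^2\right)^*\circ B^*B\mathfrak L.$$
   Context: Notation. All Hilbert spaces are finite-dimensional and real. $\Gamma_0(\mathcal H)$: proper lower semicontinuous convex functions $\mathcal H\to(-\infty,\infty]$; $\mathcal B(\mathcal H,\mathcal K)$: linear operators; $L^*$: adjoint; $\varphi^*$: Legendre–Fenchel conjugate; $\operatorname{dom}\varphi=\{x\mid\varphi(x)<\infty\}$; $M\succeq0$: self-adjoint positive semidefinite. $\varphi\in\Gamma_0(\mathcal H)$ is coercive if $\varphi(x)\to\infty$ as $\|x\|\to\infty$. For $M\succeq0$, $q_M(x)=\frac12\langle Mx,x\rangle$. For $\alpha>0$, a proper lower semicontinuous $\varphi:\mathcal H\to(-\infty,\infty]$ is $\alpha$-strongly (resp. $\alpha$-weakly) convex relative to $q_M$ if $\varphi-\alpha q_M$ (resp. $\varphi+\alpha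 q_M$) is convex over $\mathcal H$. Setting. $\mathcal X,\mathcal Y,\mathcal Z,\widetilde{\mathcal Z},\mathfrak Z$ are finite-dimensional real Hilbert spaces; $A\in\mathcal B(\mathcal X,\mathcal Y)$; $f\in\Gamma_0(\mathcal Y)$ is (real-valued and) differentiable over $\mathcal Y$ with $\beta_{\nabla f}$-Lipschitz continuous gradient; $\Psi\in\Gamma_0(\mathcal Z)$ is coercive (and prox-friendly, i.e. its proximity operators are computable, a purely computational requirement); $\mu>0$; $\mathfrak L\in\mathcal B(\mathcal X,\mathcal Z)$; $\Delta\subset\mathfrak Z$ is a closed convex set (simple, i.e. its metric projection is computable); $\mathfrak C\in\mathcal B(\mathcal X,\mathfrak Z)$; $B\in\mathcal B(\mathcal Z,\widetilde{\mathcal Z})$; and $\operatorname{dom}(\Psi\circ\mathfrak L)\cap\mathfrak C^{-1}(\Delta)\neq\emptyset$. The generalized Moreau enhanced (GME) function of $\Psi$ is $$\Psi_B(\cdot)=\Psi(\cdot)-\min_{v\in\mathcal Z}\Big[\Psi(v)+\tfrac12\|B(\cdot-v)\|_{\widetilde{\mathcal Z}}^2\Big].$$ *)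

(* Defs.v *)
From HB Require Import structures.
From mathcomp Require Import all_boot all_order all_algebra.
From mathcomp Require Import all_classical all_reals all_analysis.

Set Implicit Arguments.
Unset Strict Implicit.
Unset Printing Implicit Defensive.

Import Order.TTheory GRing.Theory Num.Theory.
Import numFieldNormedType.Exports.

Local Open Scope classical_set_scope.
Local Open Scope ring_scope.

(* A finite-dimensional normed space over R whose norm (hence topology) is the
   one induced by the inner product; positive definiteness of [inner] follows
   from [innerxx]. *)
HB.mixin Record isInnerProduct (R : realType) H
    & NormedModule R H & Vector R H := {
  inner : H -> H -> R ;
  innerC : forall x y : H, inner x y = inner y x ;
  innerDl : forall x y z : H, inner (x + y) z = inner x z + inner y z ;
  innerZl : forall (a : R) (x y : H), inner (a *: x) y = a * inner x y ;
  innerxx : forall x : H, inner x x = `|x| ^+ 2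
}.

#[short(type="hilbertType")]
HB.structure Definition FinHilbert (R : realType) :=
  {H of NormedModule R H & Vector R H & isInnerProduct R H}.

(* The linear operators B(H, K) are the library's 'Hom(H, K); composition is
   (f \o g)%VF, and addition and scaling are those of the vector space
   'Hom(H, K). *)
Section Operators.
Context {R : realType}.

Definition innerl {H : hilbertType R} (z : H) : H -> R^o := inner z.

Lemma innerl_is_linear (H : hilbertType R) (z : H) : linear (innerl z).
Proof.
move=> a x y.
by rewrite /innerl innerC innerDl innerZl (innerC x) (innerC y).
Qed.

HB.instance Definition _ (H : hilbertType R) (z : H) :=
  GRing.isLinear.Build R H R^o _ (innerl z) (innerl_is_linear z).

Lemma riesz (H : hilbertType R) (phi : 'Hom(H, R^o)) :
  exists z : H, forall x, phi x = inner z x.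
Proof.
have Lin : linear (fun z : H => linfun (innerl z)).
  move=> a x y; apply/lfunP => u; rewrite add_lfunE scale_lfunE !lfunE /=.
  by rewrite /innerl innerDl innerZl.
pose mF := GRing.isLinear.Build R H 'Hom(H, R^o) _ _ Lin.
pose F : {linear H -> 'Hom(H, R^o)} :=
  HB.pack (fun z : H => linfun (innerl z)) mF.
have FE z u : linfun F z u = inner z u.
  by rewrite (lfunE F); exact: (lfunE (innerl z)).
have kerF : lker (linfun F) == 0%VS.
  apply/lker0P => x y /lfunP /(_ (x - y)); rewrite !FE => e.
  have : inner (x - y) (x - y) = 0.
    rewrite {1}(_ : x - y = (-1) *: y + x); last by rewrite scaleN1r addrC.
    by rewrite innerDl innerZl mulN1r e addNr.
  by rewrite innerxx => /eqP; rewrite expf_eq0 /= normr_eq0 subr_eq0 => /eqP.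
have imF : limg (linfun F) = fullv.
  apply/eqP; rewrite eqEdim subvf /=.
  have := limg_ker_dim (linfun F) fullv.
  rewrite (eqP kerF) capv0 dimv0 add0n => ->.
  by rewrite !dimvf /dim /= muln1.
have : phi \in limg (linfun F) by rewrite imF memvf.
by case/memv_imgP => z _ ->; exists z => x; rewrite FE.
Qed.

(* The element selected by xget exists and is unique; see [adjointP]. *)
Definition adjoint {H K : hilbertType R} (L : 'Hom(H, K)) : 'Hom(K, H) :=
  xget 0 [set M : 'Hom(K, H) | forall x y, inner (L x) y = inner x (M y)].

Lemma adjointP (H K : hilbertType R) (L : 'Hom(H, K)) x y :
  inner (L x) y = inner x (adjoint L y).
Proof.
rewrite /adjoint; move: x y; case: xgetP => [M _ //|noM].
have ex y : exists z : H, forall x, inner y (L x) = inner z x.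
  have [z zP] := riesz (linfun (innerl y) \o L)%VF.
  by exists z => x; rewrite -zP comp_lfunE (lfunE (innerl y)).
pose g y := sval (cid (ex y)).
have gE y x : inner x (g y) = inner (L x) y.
  by rewrite innerC -(svalP (cid (ex y))) innerC.
have g_lin : linear g.
  move=> a y z; apply/eqP; rewrite -subr_eq0 -normr_eq0 -sqrf_eq0 -innerxx.
  set w := _ - _; rewrite -[inner w w]/(innerl w w) {2}/w.
  rewrite linearB linearP /= /innerl !gE -[inner _ (_ + _)]/(innerl (L w) _).
  by rewrite linearP subrr.
pose mg := GRing.isLinear.Build R K H _ _ g_lin.
pose G : {linear K -> H} := HB.pack g mg.
have [] := noM (linfun G).
by move=> x y; rewrite (lfunE G) gE.
Qed.

Definition psd {H : hilbertType R} (M : 'End(H)) :=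
  adjoint M = M /\ forall x, 0 <= inner (M x) x.

Definition quad {H : hilbertType R} (M : 'End(H)) (x : H) : R :=
  2^-1 * inner (M x) x.

(* The Riesz representative of the Frechet differential. *)
Definition gradient {H : hilbertType R} (f : H -> R) (x : H) : H :=
  xget 0 [set g : H | forall h, 'd f x h = inner g h].

End Operators.

Section ConvexAnalysis.
Context {R : realType}.
Local Open Scope ereal_scope.

Definition edom {T : Type} (phi : T -> \bar R) : set T :=
  [set x | phi x < +oo].

Definition eproper {T : Type} (phi : T -> \bar R) :=
  (forall x, phi x != -oo) /\ edom phi !=set0.

(* Only used for functions that do not take the value -oo. *)
Definition econvex {H : lmodType R} (phi : H -> \bar R) :=
  forall (x y : H) (t : R), (0 <= t <= 1)%R ->
    phi (t *: x + (1 - t) *: y)%R <= t%:E * phi x + (1 - t)%:E * phi y.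

Definition Gamma0 {H : hilbertType R} (phi : H -> \bar R) :=
  [/\ eproper phi, lower_semicontinuous phi & econvex phi].

Definition coercive {H : hilbertType R} (phi : H -> \bar R) :=
  forall m : R, exists r : R, forall x : H, (r < `|x|)%R -> m%:E < phi x.

Definition conjugate {H : hilbertType R} (phi : H -> \bar R) (u : H) : \bar R :=
  ereal_sup (range (fun x : H => (inner x u)%:E - phi x)).

Definition strongly_convex_rel {H : hilbertType R} (alpha : R) (M : 'End(H))
    (phi : H -> \bar R) :=
  [/\ (0 < alpha)%R, psd M, eproper phi, lower_semicontinuous phi
    & econvex (fun x => phi x - (alpha * quad M x)%:E)].

Definition weakly_convex_rel {H : hilbertType R} (alpha : R) (M : 'End(H))
    (phi : H -> \bar R) :=
  [/\ (0 < alpha)%R, psd M, eproper phi, lower_semicontinuous phi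
    & econvex (fun x => phi x + (alpha * quad M x)%:E)].

(* The least element of S, not merely its infimum; +oo is a junk value used
   when there is none. *)
Definition emin (S : set (\bar R)) : \bar R :=
  xget +oo [set m | S m /\ lbound S m].

Definition GME {Z Zt : hilbertType R} (Psi : Z -> \bar R) (B : 'Hom(Z, Zt))
    (z : Z) : \bar R :=
  Psi z - emin (range (fun v : Z => Psi v + (2^-1 * `|B (z - v)| ^+ 2)%:E)).

Definition add_halfsq {Z Zt : hilbertType R} (Psi : Z -> \bar R)
    (B : 'Hom(Z, Zt)) (z : Z) : \bar R :=
  Psi z + (2^-1 * `|B z| ^+ 2)%:E.

End ConvexAnalysis.

(* Main.v *)
Require Import Defs.
From HB Require Import structures.
From mathcomp Require Import all_boot all_order all_algebra.
From mathcomp Require Import all_classical all_reals all_analysis.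
From mathcomp Require Import ring lra.
Import Order.TTheory GRing.Theory Num.Theory.
Import numFieldNormedType.Exports.
Import VectorInternalTheory.
Local Open Scope classical_set_scope.
Local Open Scope ring_scope.

(* Expanding |B(z - v)|^2 / 2 turns the minimum in the GME function into
   |B z|^2 / 2 minus the conjugate of Psi + |B .|^2 / 2 at B^* B z.  The minimum
   is attained because Psi is lower semicontinuous and coercive and balls are
   compact, so the conjugate is real-valued on the range of B^* B; it is convex
   and lower semicontinuous as a supremum of affine functions.  The convexity
   statements follow by adding the quadratic forms q_{L^* B^* B L} and
   q_Lambda o A, since f o A - mu q_{L^* B^* B L}
   = (f - q_Lambda) o A + q_{A^* Lambda A - mu L^* B^* B L}. *)

(** * Algebra and continuity of the inner product *)

Section InnerProduct.
Context {R : realType}.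
Implicit Types H K : hilbertType R.

Lemma innerDr H (x y z : H) : inner x (y + z)%R = (inner x y + inner x z)%R.
Proof. by rewrite innerC innerDl !(innerC x). Qed.

Lemma innerZr H (a : R) (x y : H) : inner x (a *: y)%R = (a * inner x y)%R.
Proof. by rewrite innerC innerZl innerC. Qed.

Lemma inner_inj H (y z : H) : (forall x, inner x y = inner x z) -> y = z.
Proof.
move=> e; apply/eqP; rewrite -subr_eq0 -normr_eq0 -sqrf_eq0 -innerxx.
by rewrite innerDr -(scaleN1r z) innerZr e mulN1r subrr.
Qed.

Lemma adjoint_unique H K (L : 'Hom(H, K)) (M : 'Hom(K, H)) :
  (forall x y, inner (L x) y = inner x (M y)) -> adjoint L = M.
Proof.
move=> LM; apply/lfunP => y; apply: inner_inj => x.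
by rewrite -adjointP LM.
Qed.

Lemma normB_sq H (x y : H) :
  (`|x - y| ^+ 2 = `|x| ^+ 2 - 2 * inner x y + `|y| ^+ 2)%R.
Proof.
rewrite -!innerxx !innerDr !innerDl -(scaleN1r y) !innerZr !innerZl (innerC y x).
by ring.
Qed.

Lemma inner_continuous H (z : H) : continuous (inner z : H -> R).
Proof.
(* polarization *)
have -> : (inner z : H -> R) =
    (fun x => 2^-1 * (`|z| ^+ 2 + `|x| ^+ 2 - `|z - x| ^+ 2))%R.
  by apply/funext => x; rewrite normB_sq; field.
move=> x; apply: cvgM; first exact: cvg_cst.
have zx : z - y @[y --> x] --> (z - x)%R.
  by apply: cvgB; [exact: cvg_cst | exact: cvg_id].
have sq (g : H -> H) (l : H) : g y @[y --> x] --> l ->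
    (`|g y| ^+ 2)%R @[y --> x] --> (`|l| ^+ 2)%R.
  by move=> gl; rewrite expr2; under eq_fun do rewrite expr2;
     apply: cvgM; exact: cvg_norm gl.
apply: cvgB; last exact: sq.
by apply: cvgD; [exact: cvg_cst | exact: (sq id)].
Qed.

End InnerProduct.

(** * Continuity of linear maps and compactness of balls in finite dimension *)

Section FiniteDimension.
Context {R : realType}.
Implicit Types H K : hilbertType R.

Lemma linear_rV_continuous (V : normedModType R) n
  (g : {linear 'rV[R]_n -> V}) : continuous g.
Proof.
have -> : (g : 'rV[R]_n -> V) =
    (fun u => \sum_(i < n) u 0%R i *: g (delta_mx 0 i))%R.
  apply/funext => u; rewrite {1}[u]row_sum_delta linear_sum.
  by apply: eq_bigr => i _; rewrite linearZ.
apply: continuous_big => [|i _ u]; first exact: add_continuous.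
by apply: cvgZr_tmp;
  [exact: (nbhs_filter u) | exact: (@coord_continuous R 1 n 0%R i u)].
Qed.

(** Each coordinate is a linear form, hence by [riesz] an inner product with a fixed vector. This is
    what ties the topology of row vectors to the norm of [H]. *)
Lemma v2r_continuous H : continuous (v2r : H -> 'rV[R]_(dim H)).
Proof.
have coord (i : 'I_(dim H)) : exists z : H, forall x, (v2r x) 0%R i = inner z x.
  pose c (x : H) : R^o := (v2r x) 0%R i.
  have c_lin : linear c by move=> a x y; rewrite /c linearP !mxE.
  pose mc := GRing.isLinear.Build R H R^o _ _ c_lin.
  pose C : {linear H -> R^o} := HB.pack c mc.
  have [z zP] := riesz (linfun C).
  by exists z => x; rewrite -zP (lfunE C).
have -> : (v2r : H -> 'rV[R]_(dim H)) =
    (fun x => \sum_(i < dim H)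
       inner (sval (cid (coord i))) x *: delta_mx 0 i)%R.
  apply/funext => x; rewrite [LHS]row_sum_delta; apply: eq_bigr => i _.
  by case: cid => z /= ->.
apply: continuous_big => [|i _ x]; first exact: add_continuous.
by apply: cvgZr_tmp; exact: inner_continuous.
Qed.

Lemma lfun_continuous H K (L : 'Hom(H, K)) : continuous L.
Proof.
have -> : (L : H -> K) = (L \o r2v) \o v2r by apply/funext => x /=; rewrite v2rK.
move=> x; apply: continuous_comp; first exact: v2r_continuous.
exact: linear_rV_continuous.
Qed.

Lemma halfsq_continuous H K (L : 'Hom(H, K)) :
  continuous (fun x => 2^-1 * `|L x| ^+ 2)%R.
Proof.
have cn : continuous (fun x => `|L x|%R).
  by move=> x; apply: cvg_norm; exact: lfun_continuous.
move=> x; apply: cvgM; first exact: cvg_cst.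
by rewrite expr2; under eq_fun do rewrite expr2; apply: cvgM; exact: cn.
Qed.

Lemma norm_le_closed (V : normedModType R) (r : R) :
  closed [set x : V | (`|x| <= r)%R].
Proof.
have := @preimage_closed V R (fun x => `|x|) [set s : R | s <= r] _ (@closed_le R r).
by apply=> x _; exact: norm_continuous.
Qed.

(** Compactness is transported from row vectors: [v2r] is bounded by some [M], so the ball is a
    closed subset of the image under [r2v] of the compact ball of radius [M * r]. *)
Lemma ball_compact H (r : R) : compact [set x : H | (`|x| <= r)%R].
Proof.
have /linear_boundedP bnd : bounded_near (v2r : {linear H -> _}) (nbhs (0 : H)).
  by apply: continuous_linear_bounded; exact: v2r_continuous.
near +oo_R => M.
have Mv : forall x : H, (`|v2r x| <= M * `|x|)%R by near: M.
have M0 : (0 <= M)%R by near: M; exact: nbhs_pinfty_ge.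
have cpt : compact [set u : 'rV[R]_(dim H) | (`|u| <= M * r)%R].
  apply: bounded_closed_compact.
    by exists (M * r)%R; split; rewrite ?num_real// => s rs u /= /le_trans; apply;
      exact: ltW.
  exact: norm_le_closed.
have := continuous_compact _ cpt.
move=> /(_ _ (r2v : _ -> H)) r2v_cpt.
apply: (subclosed_compact _ (r2v_cpt _)).
- exact: norm_le_closed.
- by apply: continuous_subspaceT; exact: linear_rV_continuous.
move=> x /= xr; exists (v2r x); last exact: v2rK.
by rewrite /= (le_trans (Mv x))// ler_wpM2l.
Unshelve. all: by end_near. Qed.

End FiniteDimension.

Local Open Scope ereal_scope.

(** * Calculus of lower semicontinuous extended-real functions *)

Section LowerSemicontinuity.
Context {R : realType}.

Lemma lsc_nearP (T : topologicalType) (g : T -> \bar R) :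
  lower_semicontinuous g <->
  forall x (a : R), a%:E < g x -> \forall y \near x, a%:E < g y.
Proof.
split=> lg x a ax; first by have [V Vx Va] := lg x a ax; exact: filterS Vx.
by exists [set y | a%:E < g y] => //; exact: lg.
Qed.

Lemma lscD (T : topologicalType) (g h : T -> \bar R) :
  (forall x, g x != -oo) -> (forall x, h x != -oo) ->
  lower_semicontinuous g -> lower_semicontinuous h ->
  lower_semicontinuous (fun x => g x + h x).
Proof.
move=> gNy hNy /lsc_nearP lg /lsc_nearP lh; apply/lsc_nearP => x a agh.
(* The bound [a] is split into a part [b] below [g x] and a part [a - b] below [h x]. If both values
   are real, each receives half of the slack; otherwise a margin of 1 below the real one
   suffices. *)
suff [b [bg abh]] : exists b : R, b%:E < g x /\ (a - b)%:E < h x.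
  near=> y; rewrite (_ : a = b + (a - b))%R; last by ring.
  by rewrite EFinD; apply: lteD; near: y; [exact: lg | exact: lh].
move: agh (gNy x) (hNy x); case: (g x) => [r| |]; case: (h x) => [s| |] //= agh _ _.
- exists (r - (r + s - a) / 2)%R; move: agh; rewrite -EFinD !lte_fin => agh.
  by split; lra.
- by exists (r - 1)%R; rewrite lte_fin ltry; split => //; lra.
- by exists (a - s + 1)%R; rewrite lte_fin ltry; split => //; lra.
- by exists 0%R; rewrite !ltry.
Unshelve. all: by end_near. Qed.

Lemma lscZ (T : topologicalType) (k : R) (g : T -> \bar R) :
  (0 < k)%R -> lower_semicontinuous g ->
  lower_semicontinuous (fun x => k%:E * g x).
Proof.
move=> k0 /lsc_nearP lg; apply/lsc_nearP => x a.
have e y : (a%:E < k%:E * g y) = ((k^-1 * a)%:E < g y).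
  by rewrite EFinM lte_pdivrMl.
by rewrite e => /lg; apply: filterS => y; rewrite e.
Qed.

Lemma lsc_comp (T U : topologicalType) (g : U -> \bar R) (c : T -> U) :
  continuous c -> lower_semicontinuous g -> lower_semicontinuous (g \o c).
Proof.
move=> cc /lsc_nearP lg; apply/lsc_nearP => x a /lg; exact: cc.
Qed.

Lemma continuous_lsc (T : topologicalType) (g : T -> R) :
  continuous g -> lower_semicontinuous (EFin \o g).
Proof.
move=> cg; apply/lsc_nearP => x a /=; rewrite lte_fin => ax.
by near=> y; rewrite lte_fin; near: y; exact: cvgr_gt (cg x) _ ax.
Unshelve. all: by end_near.
Qed.

(** A real strictly below the supremum is already exceeded by a single member, whose semicontinuity
    provides the neighbourhood. *)
Lemma lsc_sup (T : topologicalType) I (g : I -> T -> \bar R) :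
  (forall i, lower_semicontinuous (g i)) ->
  lower_semicontinuous (fun x => ereal_sup (range (fun i => g i x))).
Proof.
move=> lg; apply/lsc_nearP => x a /ereal_sup_gt[_ [i _ <-] /=].
have /lsc_nearP lgi := lg i.
move=> /lgi; apply: filterS => y /lt_le_trans; apply.
by apply: ereal_sup_ubound; exists i.
Qed.

(** The strict sublevel sets of [g] in [K], at levels above the infimum, generate a proper filter.
    Compactness gives it a cluster point, which lower semicontinuity forces to be a minimiser. *)
Lemma lsc_compact_min (T : topologicalType) (g : T -> \bar R) (K : set T) :
  lower_semicontinuous g -> compact K -> K !=set0 ->
  exists2 v, K v & forall w, K w -> g v <= g w.
Proof.
move=> /lsc_nearP lg cK [w0 Kw0].
pose m := ereal_inf (g @` K).
have mK w : K w -> m <= g w by move=> Kw; apply: ereal_inf_lbound; exists w.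
(* If the infimum is [+oo], no level lies above it and the filter would have no base; but then [g]
   is constant on [K]. *)
have [my|mNy] := eqVneq m +oo.
  by exists w0 => // w /mK; rewrite my leye_eq => /eqP ->; rewrite leey.
pose F := filter_from [set a : \bar R | m < a]
  (fun a => K `&` [set w | g w < a]).
have FF : ProperFilter F.
  apply: filter_from_proper => [|a /ereal_inf_lt[_ [w Kw <-] wa]]; last by exists w.
  apply: filter_from_filter => [|a b ma mb].
    by exists +oo; rewrite /= ltey.
  exists (Order.min a b); first by rewrite /= lt_min ma.
  by move=> w [Kw /=]; rewrite lt_min => /andP[].
have [|p [Kp Fp]] := cK F FF.
  by exists +oo; [rewrite /= ltey | move=> w []].
exists p => // w /mK; apply: le_trans; rewrite leNgt; apply/negP => mp.
(* A real level [a] separates the infimum from [g p]: the sublevel set at [a] belongs to the filter,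
   yet [g] exceeds [a] near [p], so [p] could not be a cluster point. *)
have [a ma ap] : exists2 a : R, m < a%:E & a%:E < g p.
  move: mp mNy; case: m {mK F FF Fp} => [r| |] //; case: (g p) => [s| |] //.
  - rewrite lte_fin => rs _; exists ((r + s) / 2)%R; rewrite lte_fin; lra.
  - by exists (r + 1)%R; rewrite ?ltry// lte_fin; lra.
  - by exists (s - 1)%R; rewrite ?ltNyr// lte_fin; lra.
  - by exists 0%R; rewrite ?ltNyr ?ltry.
have Fa : F (K `&` [set w | g w < a%:E]) by exists a%:E.
have [w' [[_ /= w'a] aw']] := Fp _ _ Fa (lg p a ap).
by have := lt_trans aw' w'a; rewrite ltxx.
Qed.

End LowerSemicontinuity.

(** * Convexity of extended-real functions, quadratic forms and conjugates *)

Section Convexity.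
Context {R : realType}.

Lemma mule_neqNy (t : R) (a : \bar R) :
  (0 <= t)%R -> a != -oo -> t%:E * a != -oo.
Proof.
move=> t0; case: a => // _; rewrite -ltNye.
by apply: (@lt_le_trans _ _ 0); rewrite ?ltNyr// mule_ge0 ?lee_fin ?leey.
Qed.

(** Excluding [-oo] rules out the sum of opposite infinities, the case in which distributivity can
    fail. *)
Lemma muleDr_neqNy (t : R) (a b : \bar R) :
  a != -oo -> b != -oo -> t%:E * (a + b) = t%:E * a + t%:E * b.
Proof. by move=> aNy bNy; rewrite muleDr//; case: a b aNy bNy => [?||] [?||]. Qed.

Lemma econvexD (V : lmodType R) (g h : V -> \bar R) :
  (forall x, g x != -oo) -> (forall x, h x != -oo) ->
  econvex g -> econvex h -> econvex (fun x => g x + h x).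
Proof.
move=> gNy hNy cg ch x y t t01; rewrite !muleDr_neqNy// addeACA.
by apply: leeD; [exact: cg | exact: ch].
Qed.

Lemma econvexZ (V : lmodType R) (k : R) (g : V -> \bar R) :
  (0 <= k)%R -> (forall x, g x != -oo) ->
  econvex g -> econvex (fun x => k%:E * g x).
Proof.
move=> k0 gNy cg x y t t01; have /andP[t0 t1] := t01.
rewrite !(muleCA _ k%:E) -muleDr_neqNy ?mule_neqNy ?subr_ge0//.
by apply: lee_wpmul2l; [rewrite lee_fin | exact: cg].
Qed.

Lemma econvex_comp (V W : lmodType R) (l : {linear V -> W}) (g : W -> \bar R) :
  econvex g -> econvex (g \o l).
Proof. by move=> cg x y t t01; rewrite /= linearD !linearZ; exact: cg. Qed.

Lemma quad_econvex (H : hilbertType R) (M : 'End(H)) :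
  psd M -> econvex (EFin \o quad M).
Proof.
move=> [Madj M0] x y t /andP[t0 t1].
rewrite /= -!EFinM -EFinD lee_fin -subr_ge0.
have sym : inner (M y) x = inner (M x) y by rewrite adjointP Madj innerC.
(* The convexity gap of a quadratic form is [t * (1 - t)] times the form at [x - y]; symmetry of [M]
   merges the cross terms. *)
have -> : (t * quad M x + (1 - t) * quad M y - quad M (t *: x + (1 - t) *: y) =
    2^-1 * (t * (1 - t) * inner (M (x - y)) (x - y)))%R.
  rewrite /quad -(scaleN1r y) !(linearD M) !(linearZ_LR M) /= !innerDr !innerDl.
  by rewrite !innerZr !innerZl sym; field.
by rewrite !mulr_ge0// subr_ge0.
Qed.

Lemma conjugate_lsc (H : hilbertType R) (phi : H -> \bar R) :
  lower_semicontinuous (conjugate phi).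
Proof.
apply: (@lsc_sup _ _ _ (fun x u => (inner x u)%:E - phi x)) => x.
case: (phi x) => [r| |].
- apply: (@continuous_lsc _ _ (fun u => inner x u - r)%R) => u.
  by apply: cvgB; [exact: inner_continuous | exact: cvg_cst].
- by move=> u a.
- by apply/lsc_nearP => u a _; apply: nearW => v; rewrite /= ltry.
Qed.

Lemma conjugate_econvex (H : hilbertType R) (phi : H -> \bar R) :
  (forall x, phi x != -oo) -> econvex (conjugate phi).
Proof.
move=> phiNy u v t /andP[t0 t1]; apply: ge_ereal_sup => _ [x _ <-].
(* A point where [phi] is [+oo] contributes only [-oo] to the supremum; every other term is affine
   in the dual variable. *)
move: (phiNy x); case E : (phi x) => [r| |] //= _; last by rewrite leNye.
have ub w : (inner x w - r)%:E <= conjugate phi w.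
  by apply: ereal_sup_ubound; exists x => //; rewrite E.
rewrite innerDr !innerZr.
have -> : (t * inner x u + (1 - t) * inner x v)%:E - r%:E =
    t%:E * (inner x u - r)%:E + (1 - t)%:E * (inner x v - r)%:E.
  by rewrite -!EFinM -!EFinD; congr EFin; ring.
by apply: leeD; apply: lee_wpmul2l; rewrite ?lee_fin ?subr_ge0.
Qed.

End Convexity.

(** * The Moreau-type minimum and its expression as a conjugate *)

Section GeneralizedMoreauEnhancement.
Context {R : realType} {Z Zt : hilbertType R}.
Variables (Psi : Z -> \bar R) (B : 'Hom(Z, Zt)).
Hypotheses (Psi_proper : eproper Psi) (Psi_lsc : lower_semicontinuous Psi).
Hypothesis Psi_coercive : coercive Psi.

Let obj (z v : Z) : \bar R := Psi v + (2^-1 * `|B (z - v)| ^+ 2)%:E.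

Lemma moreau_argmin (z : Z) : exists v, forall w, obj z v <= obj z w.
Proof.
have [PsiNy [v1 /= v1dom]] := Psi_proper.
have obj_lsc : lower_semicontinuous (obj z).
  apply: lscD => //.
  have cB : continuous (fun v => z - v)%R.
    by move=> v; apply: cvgB; [exact: cvg_cst | exact: cvg_id].
  exact: (lsc_comp _ _ _ _ cB (continuous_lsc _ _ (halfsq_continuous _ _ B))).
have [c cE] : exists c : R, obj z v1 = c%:E.
  rewrite /obj; move: (PsiNy v1) v1dom; rewrite /edom /=.
  by case: (Psi v1) => // s _ _; exists (s + 2^-1 * `|B (z - v1)| ^+ 2)%R.
(* Outside radius [r], [Psi] alone exceeds the value [c] of the objective at [v1]. Enlarging the
   ball to contain [v1] therefore makes its minimiser global. *)
have [r rP] := Psi_coercive c.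
have [|v _ vmin] := lsc_compact_min _ _ _ obj_lsc (ball_compact Z (Num.max r `|v1|)%R).
  by exists v1; rewrite /= le_max lexx orbT.
exists v => w; have [wr|rw] := leP `|w|%R (Num.max r `|v1|)%R; first exact: vmin.
apply: (@le_trans _ _ (obj z v1)).
  by apply: vmin; rewrite /= le_max lexx orbT.
rewrite cE (le_trans (ltW (rP w _)))//.
  by rewrite (le_lt_trans _ rw)// le_max lexx.
by rewrite leeDl// lee_fin mulr_ge0// sqr_ge0.
Qed.

(** A least element is unique by antisymmetry, so the choice made in [emin] must return it and the
    default [+oo] is avoided. *)
Lemma emin_range {T} (g : T -> \bar R) (v : T) :
  (forall w, g v <= g w) -> emin (range g) = g v.
Proof.
move=> gmin; apply: xget_unique => [|m [[w _ <-] lbw]].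
  by split; [exists v | move=> _ [w _ <-]; exact: gmin].
by apply/eqP; rewrite eq_le gmin andbT; apply: lbw; exists v.
Qed.

(* Expanding the square turns the minimum over [v] into a conjugate:
   [|B(z - v)|^2 / 2 = |B z|^2 / 2 - <v, B^* B z> + |B v|^2 / 2]. *)
Lemma GME_conjugate (z : Z) : exists c : R,
  conjugate (add_halfsq Psi B) (adjoint B (B z)) = c%:E /\
  GME Psi B z = Psi z + (c - 2^-1 * `|B z| ^+ 2)%:E.
Proof.
have [PsiNy [v1 /= v1dom]] := Psi_proper.
have [v vmin] := moreau_argmin z.
have [r rE] : exists r : R, Psi v = r%:E.
  have := vmin v1; rewrite /obj; move: (PsiNy v1) (PsiNy v) v1dom; rewrite /edom /=.
  by case: (Psi v1) => // s _; case: (Psi v) => // r _ _ _; exists r.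
have sqE w : (2^-1 * `|B (z - w)| ^+ 2 =
    2^-1 * `|B z| ^+ 2 - inner w (adjoint B (B z)) + 2^-1 * `|B w| ^+ 2)%R.
  by rewrite linearB normB_sq -adjointP (innerC (B w)); field.
(* The minimiser [v] also attains the supremum defining the conjugate, so the witness is the term of
   that supremum at [v]. *)
exists (inner v (adjoint B (B z)) - (r + 2^-1 * `|B v| ^+ 2))%R; split; last first.
  rewrite /GME (emin_range _ _ vmin) /obj rE sqE.
  by case: (Psi z) => [s| |] //=; congr EFin; ring.
apply/eqP; rewrite eq_le; apply/andP; split; last first.
  by apply: ereal_sup_ubound; exists v => //; rewrite /add_halfsq rE.
apply: ge_ereal_sup => _ [w _ <-]; have := vmin w; rewrite /add_halfsq /obj rE !sqE.
move: (PsiNy w); case: (Psi w) => [s| |] //= _; last by rewrite leNye.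
by rewrite !lee_fin; lra.
Qed.

End GeneralizedMoreauEnhancement.

(** * The positive semidefinite operator behind the quadratic term *)

Section GramOperator.
Context {R : realType} {X Z Zt : hilbertType R}.
Variables (L : 'Hom(X, Z)) (B : 'Hom(Z, Zt)).
Let M : 'End(X) := (adjoint L \o adjoint B \o B \o L)%VF.

Lemma inner_gram (x y : X) : inner (M x) y = inner (B (L x)) (B (L y)).
Proof. by rewrite !comp_lfunE innerC -!adjointP innerC. Qed.

Lemma quad_gram (x : X) : quad M x = (2^-1 * `|B (L x)| ^+ 2)%R.
Proof. by rewrite /quad inner_gram innerxx. Qed.

Lemma psd_gram : psd M.
Proof.
split=> [|x]; last by rewrite inner_gram innerxx sqr_ge0.
by apply: adjoint_unique => x y; rewrite inner_gram innerC -inner_gram innerC.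
Qed.

End GramOperator.

(** * Assembly of the four claims *)

Theorem proposition2 (R : realType)
  (X Y Z Zt ZZ : hilbertType R)
  (A : 'Hom(X, Y)) (f : Y -> R) (beta : R)
  (Psi : Z -> \bar R) (mu : R) (L : 'Hom(X, Z))
  (Delta : set ZZ) (C : 'Hom(X, ZZ)) (B : 'Hom(Z, Zt))
  (f_Gamma0 : Gamma0 (EFin \o f))
  (f_diff : forall y : Y, differentiable f y)
  (f_lip : beta.-lipschitz (gradient f))
  (Psi_Gamma0 : Gamma0 Psi)
  (Psi_coercive : coercive Psi)
  (mu_gt0 : (0 < mu)%R)
  (Delta_closed : closed Delta)
  (Delta_convex : convex_set Delta)
  (feasible : edom (Psi \o L) `&` C @^-1` Delta !=set0) :
  let PsiBL : X -> \bar R := GME Psi B \o L in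
  let fA : X -> R := f \o A in
  let J : X -> \bar R := fun x => (fA x)%:E + mu%:E * PsiBL x in
  let M : 'End(X) := (adjoint L \o adjoint B \o B \o L)%VF in
  let conjBL : X -> \bar R :=
    conjugate (add_halfsq Psi B) \o (adjoint B \o B \o L)%VF in
  let d : X -> R := fun x => (fA x - mu / 2 * `|B (L x)| ^+ 2)%R in
  let C1 := strongly_convex_rel mu M (EFin \o fA) in
  let C2 := Gamma0 J in
  (* (a) *)
  [/\ (forall x, PsiBL x =
         Psi (L x) - (2^-1 * `|B (L x)| ^+ 2)%:E + conjBL x),
      Gamma0 conjBL /\ edom conjBL = setT,
      [/\ eproper PsiBL, lower_semicontinuous PsiBL
        & weakly_convex_rel 1 M PsiBL]
    & edom PsiBL = edom (Psi \o L) /\ edom (Psi \o L) !=set0] /\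
  (* (b) *)
  [/\ eproper J, lower_semicontinuous J, edom J = edom (Psi \o L)
    & edom (Psi \o L) !=set0] /\
  (* (c) *)
  (forall Lambda : 'End(Y), psd Lambda ->
     strongly_convex_rel 1 Lambda (EFin \o f) ->
     let C0 := psd ((adjoint A \o Lambda \o A)%VF - mu *: M)%R in
     [/\ C0 -> C1, C1 <-> Gamma0 (EFin \o d) & C1 -> C2]) /\
  (* (d) *)
  (C1 ->
     [/\ econvex (EFin \o d),
         econvex (fun x => mu%:E * Psi (L x)),
         econvex (fun x => mu%:E * conjBL x)
       & forall x, J x = (d x)%:E + mu%:E * Psi (L x) + mu%:E * conjBL x]).
Proof.
move=> PsiBL fA J M conjBL d C1 C2.
have [Psi_proper Psi_lsc Psi_convex] := Psi_Gamma0.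
have [PsiNy _] := Psi_proper.
have [x0 [x0dom _]] := feasible.
(* Choosing the finite conjugate values as a real function [c] leaves [Psi (L x)] as the only
   possibly infinite quantity, so later identities reduce to real arithmetic. *)
have /choice[c cP] : forall x, exists c : R,
    conjBL x = c%:E /\ PsiBL x = Psi (L x) + (c - 2^-1 * `|B (L x)| ^+ 2)%:E.
  move=> x; have [c [cE GE]] := GME_conjugate _ B Psi_proper Psi_lsc Psi_coercive (L x).
  by exists c; rewrite /conjBL /PsiBL /= !comp_lfunE.
have conjE x : conjBL x = (c x)%:E by case: (cP x).
have PsiBLE x : PsiBL x = Psi (L x) + (c x - 2^-1 * `|B (L x)| ^+ 2)%:E.
  by case: (cP x).
have conj_lsc : lower_semicontinuous conjBL.
  by apply: lsc_comp; [exact: lfun_continuous | exact: conjugate_lsc].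
have conj_convex : econvex conjBL.
  apply: econvex_comp; apply: conjugate_econvex => z; rewrite /add_halfsq.
  by move: (PsiNy z); case: (Psi z).
have conjNy x : conjBL x != -oo by rewrite conjE.
have PsiLNy x : Psi (L x) != -oo by [].
have PsiL_lsc : lower_semicontinuous (Psi \o L).
  by apply: lsc_comp => //; exact: lfun_continuous.
have PsiL_convex : econvex (Psi \o L) by exact: econvex_comp.
have sq_cont : continuous (fun x => - (2^-1 * `|B (L x)| ^+ 2))%R.
  have -> : (fun x => - (2^-1 * `|B (L x)| ^+ 2))%R =
      (fun x => - (2^-1 * `|(B \o L)%VF x| ^+ 2))%R.
    by apply/funext => x; rewrite comp_lfunE.
  by move=> x; apply: cvgN; exact: halfsq_continuous.
have sq_lsc := continuous_lsc _ _ sq_cont.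
have PsiBL_lsc : lower_semicontinuous PsiBL.
  have -> : PsiBL =
      (fun x => (Psi (L x) + conjBL x) + (- (2^-1 * `|B (L x)| ^+ 2))%:E).
    by apply/funext => x; rewrite PsiBLE conjE EFinD addeA.
  apply: lscD => //; last exact: lscD.
  by move=> x; rewrite conjE; move: (PsiLNy x); case: (Psi (L x)).
have domE : edom PsiBL = edom (Psi \o L).
  apply/funext => x; rewrite /edom /= PsiBLE; apply/propext.
  by case: (Psi (L x)) => [r| |] //; rewrite -EFinD !ltry.
have PsiBLNy x : PsiBL x != -oo.
  by rewrite PsiBLE; move: (PsiLNy x); case: (Psi (L x)).
have PsiBL_proper : eproper PsiBL by split=> //; exists x0; rewrite domE.
have [_ f_lsc _] := f_Gamma0.
have fA_lsc : lower_semicontinuous (EFin \o fA).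
  exact: (lsc_comp _ _ _ _ (lfun_continuous _ _ A) f_lsc).
have fA_proper : eproper (EFin \o fA) by split=> //; exists x0; rewrite /edom /= ltry.
have muPsiBLNy x : mu%:E * PsiBL x != -oo by rewrite mule_neqNy ?ltW.
have J_lsc : lower_semicontinuous J.
  by apply: lscD => //; exact: lscZ.
have J_dom : edom J = edom (Psi \o L).
  rewrite -domE; apply/funext => x; rewrite /edom /J /=; apply/propext.
  move: (PsiBLNy x); case: (PsiBL x) => [r| |] // _.
    by rewrite -EFinM -EFinD !ltry.
  (* Strict positivity of [mu] matters here: it keeps [mu * +oo] equal to [+oo]. *)
  by rewrite gt0_muley ?lte_fin.
have J_proper : eproper J.
  split; last by exists x0; rewrite J_dom.
  by move=> x; rewrite /J; move: (muPsiBLNy x); case: (mu%:E * _).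
have dE : (fun x => (EFin \o fA) x - (mu * quad M x)%:E) = EFin \o d.
  by apply/funext => x; rewrite /= quad_gram /d mulrA.
have JE x : J x = (d x)%:E + mu%:E * Psi (L x) + mu%:E * conjBL x.
  rewrite /J PsiBLE conjE /d; move: (PsiLNy x); case: (Psi (L x)) => [r| |] // _.
    by rewrite -!EFinM -!EFinD; congr EFin; field.
  by rewrite gt0_muley ?lte_fin.
have muPsiLNy x : mu%:E * Psi (L x) != -oo by rewrite mule_neqNy ?ltW.
have muPsiL_convex : econvex (fun x => mu%:E * Psi (L x)).
  by apply: (econvexZ _ _ (Psi \o L)) => //; exact: ltW.
have muconj_convex : econvex (fun x => mu%:E * conjBL x).
  by apply: econvexZ => //; exact: ltW.
have M_psd : psd M := psd_gram L B.
split; last split; last split.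
- split.
  + move=> x; rewrite PsiBLE conjE; case: (Psi (L x)) => [r| |] //=.
    by congr EFin; ring.
  + split; last by apply/seteqP; split=> // x _; rewrite /edom /= conjE ltry.
    by split=> //; split=> //; exists x0; rewrite /edom /= conjE ltry.
  (* Adding the form of [M] cancels the concave term exactly, leaving a sum of two convex
     functions. *)
  + split=> //; split=> //; rewrite (_ : (fun x => _) = (fun x => Psi (L x) + conjBL x)).
      exact: econvexD.
    apply/funext => x; rewrite PsiBLE conjE mul1r quad_gram -addeA -EFinD.
    by rewrite subrK.
  + by split=> //; exists x0.
- by split=> //; exists x0.
- move=> Lambda Lambda_psd [_ _ _ _ fLambda] C0; split.
  + move=> C0psd; split=> //; rewrite dE.
    have -> : EFin \o d = (fun x => (((fun y => (EFin \o f) y - (1 * quad Lambda y)%:E)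
        \o A) x) + (EFin \o quad ((adjoint A \o Lambda \o A)%VF - mu *: M)%R) x).
      apply/funext => x; rewrite -dE /=; congr EFin.
      rewrite /quad /= add_lfunE opp_lfunE scale_lfunE !comp_lfunE.
      rewrite -(scaleNr mu (adjoint L _)) innerDl innerZl.
      by rewrite (innerC (adjoint A _)) -adjointP (innerC (A x)) /fA /=; field.
    apply: econvexD => //; last exact: quad_econvex.
    exact: econvex_comp.
  + split=> [[_ _ _ _]|[_ _ d_convex]]; last by split=> //; rewrite dE.
    rewrite dE => d_convex; split=> //.
      by split=> //; exists x0; rewrite /edom /= ltry.
    (* Since [d] is real-valued, membership in [Gamma0] needs only semicontinuity besides convexity;
       it is [fA] plus a continuous term. *)
    have -> : EFin \o d = (fun x => (fA x)%:E +
        mu%:E * (- (2^-1 * `|B (L x)| ^+ 2))%:E).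
      apply/funext => x; rewrite /=; congr EFin.
      by rewrite /d; field.
    by apply: lscD => //; exact: lscZ.
  + move=> [_ _ _ _]; rewrite dE => d_convex; split=> //.
    (* The decomposition of (d) exhibits [J] as a sum of three convex functions, none taking the
       value [-oo]. *)
    rewrite (funext JE : J = _).
    apply: econvexD => //; last exact: econvexD.
      by move=> x; move: (muPsiLNy x); case: (mu%:E * _).
    by move=> x; rewrite mule_neqNy ?ltW.
- by move=> [_ _ _ _]; rewrite dE => d_convex; split.
Qed.
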